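(* Let $\mathcal{H}$ be a complex Hilbert space, let $T\in\mathcal{B}(\mathcal{H})$, and let $f,g:[0,\infty)\to[0,\infty)$ be continuous functions satisfying $f(t)g(t)=t$ for all $t\geq 0$. Then for every $\alpha\in[0,1]$, $$ \|T\|_{\alpha}^2 \leq \left\|\frac{\alpha}{4}\left( f^4(|T|)+g^4(|T^*|)\right)+(1-\alpha)|T|^2\right\|+ \frac{\alpha}{2}\left\|\Re\left(f^2(|T|)\,g^2(|T^*|)\right)\right\|.$$
   Context: $\mathcal{B}(\mathcal{H})$ denotes the $C^*$-algebra of all bounded linear operators on the complex Hilbert space $\mathcal{H}$, and $\|\cdot\|$ is the operator norm. For $T\in\mathcal{B}(\mathcal{H})$, $|T|=(T^*T)^{1/2}$, $|T^*|=(TT^* )^{1/2}$ and $\Re(T)=\frac12(T+T^* )$. For $0\leq\alpha\leq1$ the $\alpha$-norm of $T$ is $$\|T\|_{\alpha}=\sup\left\{\sqrt{\alpha|\langle Tx,x\rangle|^2+(1-\alpha)\|Tx\|^2}: x\in\mathcal{H},\ \|x\|=1\right\}.$$ Expressions such as $f^4(|T|)$ and $g^2(|T^*|)$ are defined by the continuous functional calculus, with $f^k(\cdot)=(f(\cdot))^k$. *)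

(* Defs.v *)
From HB Require Import structures.
From mathcomp Require Import all_boot all_order all_algebra.
From mathcomp Require Import sesquilinear complex.
From mathcomp Require Import all_classical all_reals all_analysis.

Set Implicit Arguments.
Unset Strict Implicit.
Unset Printing Implicit Defensive.

Import Order.TTheory GRing.Theory Num.Theory.
Import numFieldNormedType.Exports.

Local Open Scope classical_set_scope.
Local Open Scope ring_scope.
Local Open Scope complex_scope.

(* Complex Hilbert spaces. The inner product is linear in its first argument
   and conjugate-linear in the second one. *)
HB.mixin Record isHilbert (R : realType) H & CompleteNormedModule R[i] H := {
  inner : {dot H for @Num.conj R[i]};
  normr_inner : forall x : H, `|x| ^+ 2 = inner x x
}.

#[short(type="hilbertType")]
HB.structure Definition Hilbert (R : realType) :=
  {H of CompleteNormedModule R[i] H & isHilbert R H}.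

(* Norms of a normed module over R[i] take values in R[i]; [rnorm] is the same
   norm seen in R. *)
Definition rnorm (R : realType) (V : normedZmodType R[i]) (x : V) : R :=
  complex.Re `|x|.

Section BoundedOperators.
Context {R : realType} {H : hilbertType R}.

Definition bounded_pred : {pred H -> H} :=
  [pred A | `[< linear A /\ exists M : R[i], forall x, `|A x| <= M * `|x| >]].

Lemma bounded_submod_closed : submod_closed bounded_pred.
Proof.
split=> [|a A B /asboolP[lA [M bA]] /asboolP[lB [N bB]]]; apply/asboolP.
  split; first by move=> a x y; rewrite (_ : 0 = cst 0)//= scaler0 addr0.
  by exists 0 => x; rewrite (_ : 0 = cst 0)//= normr0 mul0r.
split=> [b x y|].
  by rewrite !fctE lA lB !scalerDr !scalerA [a * b]mulrC addrACA.
exists (`|a| * M + N) => x; rewrite !fctE (le_trans (ler_normD _ _))//.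
by rewrite normrZ mulrDl lerD// -mulrA ler_wpM2l.
Qed.
HB.instance Definition _ :=
  GRing.isSubmodClosed.Build R[i] (H -> H) bounded_pred bounded_submod_closed.

Record bop := Bop { bop_fun :> H -> H; _ : bop_fun \in bounded_pred }.

HB.instance Definition _ := [isSub for bop_fun].
HB.instance Definition _ := [Choice of bop by <:].
HB.instance Definition _ := [SubChoice_isSubLmodule of bop by <:].

Lemma bop_linear (A : bop) : linear A.
Proof. by case: A => A /= /asboolP[]. Qed.

HB.instance Definition _ (A : bop) :=
  GRing.isLinear.Build R[i] H H _ A (bop_linear A).

Lemma bop_bounded (A : bop) : exists M : R[i], forall x, `|A x| <= M * `|x|.
Proof. by case: A => A /= /asboolP[]. Qed.

Lemma id_bounded : (@id H) \in bounded_pred.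
Proof. by apply/asboolP; split=> //; exists 1 => x; rewrite mul1r. Qed.

Lemma comp_bounded (A B : bop) : (A \o B) \in bounded_pred.
Proof.
have [M bA] := bop_bounded A; have [N bB] := bop_bounded B.
apply/asboolP; split=> [a x y|]; first by rewrite /= !linearP.
exists (`|M| * N) => x /=; rewrite (le_trans (bA _))//.
have : `|M| * `|B x| <= `|M| * (N * `|x|) by rewrite ler_wpM2l.
rewrite -mulrA; apply: le_trans.
have [->|Bx0] := eqVneq `|B x| 0; first by rewrite !mulr0.
rewrite ler_wpM2r// real_ler_norm// ger0_real//.
have : 0 <= M * `|B x| by apply: le_trans (bA _).
by rewrite pmulr_lge0// lt_def Bx0 /=.
Qed.

Definition bop_one : bop := Bop id_bounded.
Definition bop_mul (A B : bop) : bop := Bop (comp_bounded A B).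

Fact bop_mulA : associative bop_mul.
Proof. by move=> A B C; apply: val_inj. Qed.
Fact bop_mul1 : left_id bop_one bop_mul.
Proof. by move=> A; apply: val_inj. Qed.
Fact bop_mulr1 : right_id bop_one bop_mul.
Proof. by move=> A; apply: val_inj. Qed.
Fact bop_mulDl : left_distributive bop_mul +%R.
Proof. by move=> A B C; apply: val_inj. Qed.
Fact bop_mulDr : right_distributive bop_mul +%R.
Proof.
by move=> A B C; apply: val_inj; apply/funext => x /=; rewrite linearD.
Qed.

(* Multiplication is composition; H may be the zero space, hence only a
   possibly-zero ring. *)
HB.instance Definition _ := GRing.Zmodule_isPzRing.Build bop
  bop_mulA bop_mul1 bop_mulr1 bop_mulDl bop_mulDr.

Definition opnorm (A : bop) : R := sup [set rnorm (A x) | x in [set x | `|x| <= 1]].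

(* By the Riesz representation theorem the set below is a singleton. *)
Definition adjoint (A : bop) : bop :=
  xget 0 [set B : bop | forall x y, inner (A x) y = inner x (B y)].

Definition re_op (A : bop) : bop := 2^-1 *: (A + adjoint A).

Definition spectrum (A : bop) : set R[i] :=
  [set z | ~ exists B : bop, B * (A - z *: (1 : bop)) = 1 /\ (A - z *: (1 : bop)) * B = 1].

Definition polyop (p : {poly R}) (A : bop) : bop :=
  \sum_(k < size p) (p`_k)%:C *: A ^+ k.

(* Continuous functional calculus of a self-adjoint operator A at a function f
   continuous on the (real) spectrum of A: the extension by continuity of
   p |-> p(A) from the polynomials to C(spectrum A), i.e. the operator-norm
   limit of p_n(A) for any polynomials p_n converging to f uniformly on the
   spectrum. For such A and f the set below is a singleton, because
   ||p(A)|| = sup {|p(t)| : t in spectrum A} and polynomials are dense; only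
   the values of f on the spectrum matter. *)
Definition cfc (f : R -> R) (A : bop) : bop :=
  xget 0 [set B : bop | forall e : R, 0 < e -> exists p : {poly R},
    (forall t : R, spectrum A t%:C -> `|f t - p.[t]| < e) /\
    opnorm (B - polyop p A) < e].

Definition absop (A : bop) : bop := cfc Num.sqrt (adjoint A * A).

Definition alpha_norm (a : R) (A : bop) : R :=
  sup [set Num.sqrt (a * rnorm (inner (A x) x) ^+ 2
                     + (1 - a) * rnorm (A x) ^+ 2)
      | x in [set x : H | `|x| = 1]].

End BoundedOperators.

Arguments bop {R} H.

(* Main.v *)
(* By the mixed Schwarz inequality |<Tx,x>| <= ||f(|T|)x|| ||g(|T^*|)x||, so
   with F = f^2(|T|) and G = g^2(|T^*|) the arithmetic-geometric mean inequality
   gives, for a unit vector x,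
     |<Tx,x>|^2 <= (<(F + G)x,x> / 2)^2 <= ||(F + G)x||^2 / 4
                 = <(F^2 + G^2)x,x> / 4 + <Re(FG)x,x> / 2.
   The functional calculus is obtained from the estimate ||p(A)|| <= sup |p| over
   the spectrum of a self-adjoint A: with S = p(A) and nu = ||S||, the operator
   S^2 - nu^2 is not bounded below, hence neither is A - t for some root t of
   p^2 - nu^2, and then t is real and lies in the spectrum. *)

(* The usual proof of the mixed Schwarz inequality starts from the polar decomposition T = U |T|.
   Here the contraction T (|T| + d)^-1 stands in for U: inverting |T| + d only takes the
   representation theorem for coercive forms, and the price is an error of order d.

   The functions f and g are continuous on the half-line only, so before anything can be
   approximated the spectrum of a positive operator A has to be placed inside [0, ||A||].
   Weierstrass approximation on that interval and the spectral estimate for polynomials then give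
   convergence in operator norm.

   Almost all estimates use the real part of the inner product, which determines vectors and
   adjoints; the modulus of the inner product is recovered at the end by a rotation. *)
Require Import Defs.
From mathcomp Require Import all_boot all_order all_algebra.
From mathcomp Require Import sesquilinear complex.
From mathcomp Require Import all_classical all_reals all_analysis.
From mathcomp Require Import ring lra.

Set Implicit Arguments.
Unset Strict Implicit.

Import Order.TTheory GRing.Theory Num.Theory.
Import numFieldNormedType.Exports.

Local Open Scope classical_set_scope.
Local Open Scope ring_scope.
Local Open Scope complex_scope.

(** * Real inner product of a complex Hilbert space *)

Section RealInnerProduct.
Context {R : realType} {H : hilbertType R}.
Implicit Types (x y z : H) (a : R[i]) (r : R).

Lemma conjcE a : Num.conj a = conjc a.
Proof. by []. Qed.

(** This makes H a real Hilbert space with the same norm. Nothing is lost: the imaginary part of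
    [inner x y] is [rdot] of -i x and y, see [rdot_Im]. *)
Definition rdot x y : R := complex.Re (inner x y).

Lemma rdotDl x y z : rdot (x + y) z = rdot x z + rdot y z.
Proof. by rewrite /rdot linearDl raddfD. Qed.

Lemma rdotC x y : rdot x y = rdot y x.
Proof.
rewrite /rdot hermC expr0 mul1r /=.
by rewrite conjcE; case: (inner y x).
Qed.

Lemma rdotDr x y z : rdot x (y + z) = rdot x y + rdot x z.
Proof. by rewrite rdotC rdotDl !(rdotC _ x). Qed.

Lemma rdotZl a x y : rdot (a *: x) y = rdot x (conjc a *: y).
Proof.
rewrite /rdot linearZl_LR linearZr_LR /=; congr (complex.Re (_ * _)).
by rewrite !conjcE conjcK.
Qed.

Lemma rdotZrl r x y : rdot (r%:C *: x) y = r * rdot x y.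
Proof. by rewrite /rdot linearZl_LR /=; case: (inner x y) => u v; rewrite /= mul0r subr0. Qed.

Lemma rdotZrr r x y : rdot x (r%:C *: y) = r * rdot x y.
Proof. by rewrite rdotC rdotZrl rdotC. Qed.

Lemma rdotNl x y : rdot (- x) y = - rdot x y.
Proof. by rewrite /rdot linearNl raddfN. Qed.

Lemma rdotNr x y : rdot x (- y) = - rdot x y.
Proof. by rewrite rdotC rdotNl rdotC. Qed.

Lemma rdotBl x y z : rdot (x - y) z = rdot x z - rdot y z.
Proof. by rewrite rdotDl rdotNl. Qed.

Lemma rdotBr x y z : rdot x (y - z) = rdot x y - rdot x z.
Proof. by rewrite rdotDr rdotNr. Qed.

Lemma rdot0l y : rdot 0 y = 0.
Proof. by rewrite /rdot linear0l. Qed.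

Lemma rnormE (V : normedZmodType R[i]) (x : V) : (rnorm x)%:C = `|x|.
Proof. by rewrite /rnorm RRe_real// normr_real. Qed.

Lemma rnorm_ge0 (V : normedZmodType R[i]) (x : V) : 0 <= rnorm x.
Proof. by rewrite -ler0c rnormE. Qed.
Hint Resolve rnorm_ge0 : core.

Lemma rnorm_eq0 (V : normedZmodType R[i]) (x : V) : (rnorm x == 0) = (x == 0).
Proof. by rewrite -(inj_eq (@complexI R)) rnormE normr_eq0. Qed.

Lemma rnorm0 (V : normedZmodType R[i]) : rnorm (0 : V) = 0.
Proof. by apply/eqP; rewrite rnorm_eq0. Qed.

Lemma rnormN (V : normedZmodType R[i]) (x : V) : rnorm (- x) = rnorm x.
Proof. by rewrite /rnorm normrN. Qed.

Lemma rnormB (V : normedZmodType R[i]) (x y : V) : rnorm (x - y) = rnorm (y - x).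
Proof. by rewrite -rnormN opprB. Qed.

Lemma rnormD (V : normedZmodType R[i]) (x y : V) :
  rnorm (x + y) <= rnorm x + rnorm y.
Proof. by rewrite -lecR rmorphD /= !rnormE ler_normD. Qed.

Lemma rnormZ a x : rnorm (a *: x) = rnorm a * rnorm x.
Proof. by apply: (@complexI R); rewrite rmorphM /= !rnormE normrZ. Qed.

Lemma rnormr r : rnorm r%:C = `|r|.
Proof. by rewrite /rnorm normc_def /= expr0n addr0 sqrtr_sqr. Qed.

Lemma rdotxx x : rdot x x = rnorm x ^+ 2.
Proof.
apply: (@complexI R); rewrite rmorphXn /= rnormE normr_inner.
by rewrite /rdot RRe_real// -normr_inner rpredX// normr_real.
Qed.

Lemma rdot_eq x y : (forall z, rdot z x = rdot z y) -> x = y.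
Proof.
move=> e; apply/eqP; rewrite -subr_eq0 -rnorm_eq0 -sqrf_eq0 -rdotxx.
by rewrite rdotBr e subrr.
Qed.

(** The square of the norm of ||y|| x - ||x|| y is 2 ||x|| ||y|| (||x|| ||y|| - [rdot x y]). *)
Lemma rdot_CS x y : rdot x y <= rnorm x * rnorm y.
Proof.
have [/eqP|x0] := eqVneq (rnorm x) 0.
  by rewrite rnorm_eq0 => /eqP->; rewrite rdot0l mulr_ge0.
have [/eqP|y0] := eqVneq (rnorm y) 0.
  by rewrite rnorm_eq0 => /eqP->; rewrite rdotC rdot0l mulr_ge0.
have xp : 0 < rnorm x by rewrite lt_def x0 /=.
have yp : 0 < rnorm y by rewrite lt_def y0 /=.
have : 0 <= rdot ((rnorm y)%:C *: x - (rnorm x)%:C *: y)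
                 ((rnorm y)%:C *: x - (rnorm x)%:C *: y).
  by rewrite rdotxx sqr_ge0.
rewrite !(rdotBl, rdotBr, rdotZrl, rdotZrr) !rdotxx (rdotC y x) => h.
rewrite -(ler_pM2l (mulr_gt0 xp yp)) -subr_ge0.
have {}h : 0 <= 2 * (rnorm x * rnorm y * (rnorm x * rnorm y) - rnorm x * rnorm y * rdot x y).
  by move: h; congr (0 <= _); ring.
by move: h; rewrite pmulr_rge0.
Qed.

Lemma rdot_CS_norm x y : `|rdot x y| <= rnorm x * rnorm y.
Proof.
rewrite ler_norml rdot_CS andbT lerNl -rdotNl.
by rewrite (le_trans (rdot_CS _ _))// rnormN.
Qed.

Lemma rnormsqD x y :
  rnorm (x + y) ^+ 2 = rnorm x ^+ 2 + rnorm y ^+ 2 + 2 * rdot x y.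
Proof. by rewrite -!rdotxx rdotDl !rdotDr (rdotC y x); ring. Qed.

Lemma hilbert_cauchy (u : nat -> H) :
  (forall e : R, 0 < e -> exists N, forall m n, (N <= m)%N -> (N <= n)%N ->
     rnorm (u m - u n) < e) ->
  exists l, forall e : R, 0 < e -> exists N, forall n, (N <= n)%N -> rnorm (u n - l) < e.
Proof.
move=> cu.
have cvu : cvg (u @ \oo).
  apply/cauchy_cvgP/cauchy_exP => e e0.
  (* The order of [R[i]] compares only numbers with equal imaginary parts, so a positive radius is
     real. *)
  have [e1 e2] : 0 < complex.Re e /\ e = (complex.Re e)%:C.
    move: e0; rewrite ltcE /= => /andP[/eqP ie re]; split => //.
    by case: e ie re => u1 v1 /= ->.
  have [N NP] := cu _ e1.
  exists (u N); exists N => // n /= Nn.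
  rewrite -ball_normE /= e2 -rnormE ltcR.
  exact: NP.
move/cvg_ex: cvu => [l /cvgrPdist_lt ul].
exists l => e e0.
have /ul[N _ NP] : 0 < e%:C by rewrite ltcR.
exists N => n Nn.
by rewrite rnormB -ltcR rnormE; apply: NP.
Qed.

End RealInnerProduct.
#[global] Hint Extern 0 (is_true (0 <= rnorm _)) => apply: rnorm_ge0 : core.

(** * Riesz representation and operator norm *)

Section Representation.
Context {R : realType} {H : hilbertType R}.
Implicit Types (x y z : H) (r : R).

Lemma exists_invS_lt (e : R) : 0 < e ->
  exists N, forall n, (N <= n)%N -> n.+1%:R^-1 < e.
Proof.
move=> /ltr_add_invr[k]; rewrite add0r => ke; exists k => n kn.
apply: le_lt_trans ke.
by rewrite lef_pV2 ?posrE ?ltr0Sn// ler_nat ltnS.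
Qed.

Lemma quadratic_ge0_coef_eq0 (d A : R) :
  0 <= A -> (forall t, 0 <= 2 * t * d + t ^+ 2 * A) -> d = 0.
Proof.
(* The minimiser would be - d / A; the shift by 1 also covers A = 0 and still makes the value a
   negative multiple of d^2. *)
move=> A0 /(_ (- d / (A + 1))) h.
have A1 : 0 < A + 1 by lra.
have : 0 <= (2 * (- d / (A + 1)) * d + (- d / (A + 1)) ^+ 2 * A) * (A + 1) ^+ 2.
  by rewrite mulr_ge0// sqr_ge0.
have -> : (2 * (- d / (A + 1)) * d + (- d / (A + 1)) ^+ 2 * A) * (A + 1) ^+ 2
   = - (d ^+ 2 * (A + 2)) by field; rewrite gt_eqF.
rewrite oppr_ge0 => h2; apply/eqP; rewrite -sqrf_eq0 eq_le sqr_ge0 andbT.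
by rewrite -(ler_pM2r (_ : 0 < A + 2)) ?mul0r//; lra.
Qed.

(* Minimise a x x - 2 phi x: the parallelogram identity makes a minimising
   sequence Cauchy, and the Euler equation of the minimiser is the claim. *)
Lemma coercive_representation (a : H -> H -> R) (phi : H -> R) (c K M : R) :
  (forall x y z, a (x + y) z = a x z + a y z) ->
  (forall r x y, a (r%:C *: x) y = r * a x y) ->
  (forall x y, a x y = a y x) ->
  0 < c -> (forall x, c * rnorm x ^+ 2 <= a x x) ->
  0 <= K -> (forall x y, `|a x y| <= K * (rnorm x * rnorm y)) ->
  (forall x y, phi (x + y) = phi x + phi y) ->
  (forall r x, phi (r%:C *: x) = r * phi x) ->
  (forall x, `|phi x| <= M * rnorm x) ->
  exists y, forall x, a x y = phi x.
Proof.
move=> aD aZ aC c0 ac K0 aK pD pZ pM.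
have aDr x y z : a z (x + y) = a z x + a z y by rewrite aC aD !(aC z).
have aZr r x y : a y (r%:C *: x) = r * a y x by rewrite aC aZ (aC y).
have a0 x : 0 <= a x x by rewrite (le_trans _ (ac x))// mulr_ge0 ?sqr_ge0 ?(ltW c0).
pose J x := a x x - 2 * phi x.
(* Completing the square in c r^2 - 2 M r, where r is the norm of x. *)
have Jlb x : - (M ^+ 2 / c) <= J x.
  have h1 : phi x <= M * rnorm x := le_trans (ler_norm _) (pM x).
  have h2 : 0 <= (c * rnorm x - M) ^+ 2 / c by rewrite divr_ge0// ?sqr_ge0// ltW.
  have h3 : (c * rnorm x - M) ^+ 2 / c = c * rnorm x ^+ 2 - 2 * (M * rnorm x) + M ^+ 2 / c.
    by field; rewrite gt_eqF.
  rewrite h3 in h2; rewrite /J; have := ac x; lra.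
have iJ : has_inf (range J).
  split; first by exists (J 0), 0.
  by exists (- (M ^+ 2 / c)) => _ [x _ <-].
set m := inf (range J).
have mJ x : m <= J x by apply: ge_inf; [case: iJ | exists x].
have /choice[u uJ] : forall n : nat, exists x, J x < m + n.+1%:R^-1.
  move=> n; have [|_ [x _ <-] xJ] := @inf_adherent _ (range J) n.+1%:R^-1 _ iJ.
    by rewrite invr_gt0 ltr0Sn.
  by exists x.
(* As [J] is at least [m] at the midpoint, for x = [u p] and y = [u q] the right side is less than
   2/(p+1) + 2/(q+1); hence the threshold c e^2 / 4 below. *)
have parallelogram x y : a (x - y) (x - y) =
    2 * J x + 2 * J y - 4 * J ((2^-1)%:C *: (x + y)).
  have aN z w : a (- z) w = - a z w.
    by rewrite -[- z]scaleN1r (_ : -1 = (-1)%:C) ?aZ ?mulN1r// rmorphN1.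
  rewrite /J !(aD, aDr, aZ, aZr, aN, pD, pZ) !(aC _ (- y)) !(aN, aDr) (aC y x).
  by field.
have [l ul] : exists l, forall e : R, 0 < e ->
    exists N, forall n, (N <= n)%N -> rnorm (u n - l) < e.
  apply: hilbert_cauchy => e e0.
  have [|N NP] := @exists_invS_lt (c * e ^+ 2 / 4).
    by rewrite divr_gt0// mulr_gt0// exprn_gt0.
  exists N => p q Np Nq.
  have h := ac (u p - u q); rewrite parallelogram in h.
  have : c * rnorm (u p - u q) ^+ 2 < c * e ^+ 2.
    move: h (mJ ((2^-1)%:C *: (u p + u q))) (uJ p) (uJ q) (NP _ Np) (NP _ Nq).
    move: (J _) (J _) (J _) p.+1%:R^-1 q.+1%:R^-1 (rnorm _).
    clearbody m; clear=> *; lra.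
  by rewrite ltr_pM2l// ltr_pXn2r// nnegrE// ltW.
exists l => h.
apply/eqP; rewrite -subr_eq0; apply/eqP.
(* Minimality is used at [u n], where moving by t h lowers [J] by less than 1/(n+1). Replacing [u n]
   by [l] in the linear coefficient then costs at most 2 |t| K ||h|| ||u n - l||. Each error gets
   half of e. *)
apply: (@quadratic_ge0_coef_eq0 _ (a h h)) => // t.
apply/ler_addgt0Pl => e e0.
have [|N NP] := @exists_invS_lt (e / 2); first by lra.
have Kt : 0 < 2 * `|t| * (K * rnorm h) + 1.
  by rewrite ltr_wpDl// !mulr_ge0.
have [|N' NP'] := ul (e / 2 / (2 * `|t| * (K * rnorm h) + 1)).
  by rewrite !divr_gt0.
pose n := maxn N N'.
have h1 := NP n (leq_maxl _ _); have {NP'} := NP' n (leq_maxr _ _).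
rewrite ltr_pdivlMr// => h2.
have h3 := mJ (u n + t%:C *: h); have h4 := uJ n.
have h5 : J (u n + t%:C *: h) = J (u n) + 2 * t * (a h (u n) - phi h) + t ^+ 2 * a h h.
  by rewrite /J !(aD, aDr, aZ, aZr, pD, pZ) (aC (u n) h); ring.
have h6 : a h (u n) = a h (u n - l) + a h l by rewrite -aDr subrK.
have h7 : 2 * t * a h (u n - l) <= e / 2.
  apply: (le_trans (ler_norm _)); rewrite !normrM ger0_norm//.
  have : 2 * `|t| * `|a h (u n - l)| <= 2 * `|t| * (K * (rnorm h * rnorm (u n - l))).
    by rewrite ler_wpM2l// mulr_ge0.
  have := rnorm_ge0 (u n - l); lra.
rewrite h5 h6 in h3; move: h1 h3 h4 h7.
move: (J _) n.+1%:R^-1 (a h _) (a h _) (a h h) (phi h); clearbody m; clear=> *; lra.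
Qed.

Lemma riesz_rdot (phi : H -> R) (M : R) :
  (forall x y, phi (x + y) = phi x + phi y) ->
  (forall r x, phi (r%:C *: x) = r * phi x) ->
  (forall x, `|phi x| <= M * rnorm x) ->
  exists y, forall x, rdot x y = phi x.
Proof.
apply: (@coercive_representation rdot phi 1 1 M) => //.
- exact: rdotDl.
- exact: rdotZrl.
- exact: rdotC.
- by move=> x; rewrite mul1r rdotxx.
- by move=> x y; rewrite mul1r rdot_CS_norm.
Qed.

End Representation.

(** * Operator norm estimates and completeness of the operator algebra *)

Section OperatorNorm.
Context {R : realType} {H : hilbertType R}.
Implicit Types (x y z : H) (r : R) (A B C : bop H).

Lemma bop_rbounded A : exists2 M : R, 0 <= M & forall x, rnorm (A x) <= M * rnorm x.
Proof.
have [M MP] := bop_bounded A.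
(* [M] lies in [R[i]] and may be nonreal on the zero space; its norm serves in every case. *)
exists (rnorm M) => // x.
rewrite -lecR rmorphM /= !rnormE (le_trans (MP x))//.
have [->|x0] := eqVneq x 0; first by rewrite normr0 !mulr0.
rewrite ler_wpM2r// real_ler_norm// ger0_real//.
have : 0 <= M * `|x| by apply: le_trans (MP x).
by rewrite pmulr_lge0// normr_gt0.
Qed.

Lemma opnorm_has_sup A : has_sup [set rnorm (A x) | x in [set x | `|x| <= 1]].
Proof.
split; first by exists (rnorm (A 0)), 0 => //=; rewrite normr0.
have [M M0 MP] := bop_rbounded A; exists M => _ [x /= x1 <-].
rewrite (le_trans (MP x))// -[leRHS]mulr1 ler_wpM2l//.
by rewrite -lecR rnormE.
Qed.

Lemma opnorm_ge0 A : 0 <= opnorm A.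
Proof.
have [_ hA] := opnorm_has_sup A.
rewrite (le_trans (rnorm_ge0 (A 0)))//.
by apply: sup_ubound => //; exists 0 => //=; rewrite normr0.
Qed.

Lemma le_opnorm A x : rnorm (A x) <= opnorm A * rnorm x.
Proof.
have [->|x0] := eqVneq x 0; first by rewrite linear0 rnorm0 mulr0.
have xp : 0 < rnorm x by rewrite lt_def rnorm_eq0 x0 /=.
rewrite -ler_pdivrMr// mulrC.
have -> : (rnorm x)^-1 * rnorm (A x) = rnorm (A ((rnorm x)^-1%:C *: x)).
  by rewrite linearZ/= rnormZ rnormr ger0_norm// invr_ge0.
have [_ hA] := opnorm_has_sup A.
apply: sup_ubound => //; exists ((rnorm x)^-1%:C *: x) => //=.
by rewrite -rnormE rnormZ rnormr ger0_norm ?invr_ge0// mulVf ?gt_eqF.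
Qed.

Lemma opnorm_le A r : 0 <= r -> (forall x, rnorm (A x) <= r * rnorm x) ->
  opnorm A <= r.
Proof.
move=> r0 Ar; apply: ge_sup; first by case: (opnorm_has_sup A).
move=> _ [x /= x1 <-]; rewrite (le_trans (Ar x))// -[leRHS]mulr1 ler_wpM2l//.
by rewrite -lecR rnormE.
Qed.

Lemma bop_eq A B : (forall x, A x = B x) -> A = B.
Proof. by move=> AB; apply: val_inj; apply/funext. Qed.

Lemma opnorm0_eq A : opnorm A <= 0 -> A = 0.
Proof.
move=> A0; apply: bop_eq => x; apply/eqP; rewrite -rnorm_eq0 eq_le rnorm_ge0 andbT.
by rewrite (le_trans (le_opnorm A x))// mulr_le0_ge0.
Qed.

Lemma opnormD A B : opnorm (A + B) <= opnorm A + opnorm B.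
Proof.
apply: opnorm_le => [|x]; first by rewrite addr_ge0// opnorm_ge0.
by rewrite mulrDl (le_trans (rnormD _ _))// lerD// le_opnorm.
Qed.

Lemma opnormN A : opnorm (- A) = opnorm A.
Proof.
by apply/eqP; rewrite eq_le !opnorm_le ?opnorm_ge0// => x;
  have := le_opnorm (- A) x; have := le_opnorm A x; rewrite rnormN.
Qed.

Lemma opnormB A B : opnorm (A - B) = opnorm (B - A).
Proof. by rewrite -opnormN opprB. Qed.

Lemma opnormM A B : opnorm (A * B) <= opnorm A * opnorm B.
Proof.
apply: opnorm_le => [|x]; first by rewrite mulr_ge0// opnorm_ge0.
by rewrite (le_trans (le_opnorm A _))// -mulrA ler_wpM2l ?opnorm_ge0// le_opnorm.
Qed.

Lemma opnorm_dist A B C : opnorm (A - C) <= opnorm (A - B) + opnorm (B - C).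
Proof. by rewrite (le_trans _ (opnormD _ _))// addrA subrK. Qed.

Lemma bop_complete (u : nat -> bop H) :
  (forall e : R, 0 < e -> exists N, forall m n, (N <= m)%N -> (N <= n)%N ->
     opnorm (u m - u n) <= e) ->
  exists L, forall e : R, 0 < e -> exists N, forall n, (N <= n)%N ->
     opnorm (u n - L) <= e.
Proof.
move=> cu.
have /choice[L LP] : forall x, exists l, forall e : R, 0 < e ->
    exists N, forall n, (N <= n)%N -> rnorm (u n x - l) < e.
  move=> x; apply: hilbert_cauchy => e e0.
  have [|N NP] := cu (e / (rnorm x + 1)); first by rewrite divr_gt0// ltr_wpDl.
  exists N => m n Nm Nn.
  rewrite (le_lt_trans (le_opnorm (u m - u n) x))//.
  rewrite (le_lt_trans (ler_wpM2r (rnorm_ge0 x) (NP _ _ Nm Nn)))//.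
  rewrite mulrAC ltr_pdivrMr ?ltr_wpDl//.
  by rewrite ltr_pM2l// ltrDl.
have eq_limit (v w : H) : (forall e : R, 0 < e -> rnorm (v - w) <= e) -> v = w.
  move=> h; apply/eqP; rewrite -subr_eq0 -rnorm_eq0 eq_le rnorm_ge0 andbT.
  by apply/ler_addgt0Pl => e e0; rewrite addr0 h.
have linL : linear L.
  move=> a x y; apply: eq_limit => e e0.
  have e3 : 0 < e / 3 by lra.
  have ra : 0 < rnorm a + 1 by rewrite ltr_wpDl.
  have [N1 h1] := LP (a *: x + y) _ e3.
  have [|N2 h2] := LP x (e / 3 / (rnorm a + 1)); first by rewrite divr_gt0.
  have [N3 h3] := LP y _ e3.
  pose n := maxn N1 (maxn N2 N3).
  have {}h1 := h1 n (leq_maxl _ _).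
  have {}h2 := h2 n (leq_trans (leq_maxl _ _) (leq_maxr _ _)).
  have {}h3 := h3 n (leq_trans (leq_maxr _ _) (leq_maxr _ _)).
  have -> : L (a *: x + y) - (a *: L x + L y) =
     - (u n (a *: x + y) - L (a *: x + y)) + a *: (u n x - L x) + (u n y - L y).
    rewrite (linearP (u n)) scalerBr opprB opprD -!addrA; congr (_ + _).
    by rewrite (addrCA (- (a *: L x))) (addrA (a *: u n x)) addKr.
  apply: (le_trans (rnormD _ _)); apply: (le_trans (lerD (rnormD _ _) (lexx _))).
  rewrite rnormN rnormZ.
  move: h2; rewrite ltr_pdivlMr// => h2.
  have := rnorm_ge0 (u n x - L x); lra.
(* In the Cauchy estimate the second index goes to infinity at a rate depending on x, while [N] does
   not depend on x. *)
have close e : 0 < e -> exists N, forall n, (N <= n)%N ->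
    forall x, rnorm (u n x - L x) <= e * rnorm x.
  move=> e0; have [N NP] := cu _ e0; exists N => n Nn x.
  apply/ler_addgt0Pl => d d0.
  have [N' NP'] := LP x _ d0.
  have := NP' _ (leq_maxr N N').
  have := NP _ _ Nn (leq_maxl N N') => h1 h2.
  have h3 : rnorm (u n x - u (maxn N N') x) <= e * rnorm x.
    by rewrite (le_trans (le_opnorm (u n - u (maxn N N')) x))// ler_wpM2r.
  have := rnormD (u n x - u (maxn N N') x) (u (maxn N N') x - L x).
  rewrite addrA subrK; lra.
have bL : L \in bounded_pred.
  apply/asboolP; split => //.
  have [N /(_ _ (leqnn N)) NP] := close 1 ltr01.
  exists (opnorm (u N) + 1)%:C => x.
  rewrite -!rnormE -rmorphM /= lecR mulrDl -[L x](subrK (u N x)) addrC.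
  rewrite (le_trans (rnormD _ _))// lerD ?le_opnorm//.
  by rewrite rnormB NP.
exists (Bop bL) => e e0; have [N NP] := close _ e0; exists N => n Nn.
by apply: opnorm_le => [|x]; [exact: ltW|exact: NP].
Qed.

End OperatorNorm.

(** * Adjoints and self-adjoint operators *)

Section Adjoint.
Context {R : realType} {H : hilbertType R}.
Implicit Types (x y z : H) (r : R) (A B C S T : bop H).

Lemma rdot_Im x y : complex.Im (inner x y) = rdot (- 'i%C *: x) y.
Proof.
by rewrite /rdot linearZl_LR /=; case: (inner x y) => u v /=; ring.
Qed.

(** Since [adjoint] is a choice, an operator satisfying the complex identity must be exhibited.
    Riesz for [rdot] gives it for real parts, and multiplying x by -i turns imaginary parts into
    real ones. *)
Lemma adjoint_rdot A x y : rdot (A x) y = rdot x (adjoint A y).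
Proof.
suff [B AB] : exists B : bop H, forall x y, inner (A x) y = inner x (B y).
  rewrite /adjoint /rdot; congr complex.Re.
  pose P := [set B : bop H | forall x y, inner (A x) y = inner x (B y)].
  by have /(_ x y) : P (xget 0 P) by apply: xgetPex; exists B.
have /choice[B AB] : forall y, exists z, forall x, rdot x z = rdot (A x) y.
  move=> {}y; apply: (@riesz_rdot _ _ _ (opnorm A * rnorm y)).
  - by move=> u v; rewrite linearD rdotDl.
  - by move=> r u; rewrite linearZ rdotZrl.
  - move=> u; rewrite (le_trans (rdot_CS_norm _ _))// mulrAC ler_wpM2r//.
    exact: le_opnorm.
have linB : linear B.
  move=> a u v; apply: rdot_eq => w.
  have aB : rdot w (a *: B u) = rdot (A w) (a *: u).
    by rewrite -[a]conjcK -rdotZl AB linearZ/= rdotZl.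
  by rewrite rdotDr aB !AB rdotDr.
have bB : B \in bounded_pred.
  apply/asboolP; split => //; exists (opnorm A)%:C => u.
  rewrite -!rnormE -rmorphM /= lecR.
  have [->|Bu] := eqVneq (rnorm (B u)) 0; first by rewrite mulr_ge0 ?opnorm_ge0.
  have Bp : 0 < rnorm (B u) by rewrite lt_def Bu /=.
  rewrite -(ler_pM2r Bp) -expr2 -rdotxx AB (le_trans (rdot_CS _ _))//.
  by rewrite mulrAC ler_wpM2r// le_opnorm.
exists (Bop bB) => u v; apply/eqP; rewrite eq_complex.
rewrite -!/(rdot _ _) /= AB eqxx /= !rdot_Im -linearZ /= AB.
exact: eqxx.
Qed.

Lemma adjoint_unique A B : (forall x y, rdot (A x) y = rdot x (B y)) -> adjoint A = B.
Proof.
move=> AB; apply: bop_eq => y; apply: rdot_eq => x.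
by rewrite -adjoint_rdot AB.
Qed.

Lemma adjointK A : adjoint (adjoint A) = A.
Proof.
by apply: adjoint_unique => x y; rewrite rdotC -adjoint_rdot rdotC.
Qed.

Definition selfadjoint A := forall x y, rdot (A x) y = rdot x (A y).

Definition positive A := selfadjoint A /\ forall x, 0 <= rdot (A x) x.

Lemma positive_adjointM A : positive (adjoint A * A).
Proof.
split=> [x y|x] /=.
  by rewrite -adjoint_rdot rdotC -adjoint_rdot rdotC.
by rewrite rdotC -adjoint_rdot rdotxx sqr_ge0.
Qed.

Lemma selfadjoint1 : selfadjoint (1 : bop H).
Proof. by []. Qed.

Lemma selfadjointD A B : selfadjoint A -> selfadjoint B -> selfadjoint (A + B).
Proof. by move=> sA sB x y; rewrite rdotDl rdotDr sA sB. Qed.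

Lemma selfadjointZ r A : selfadjoint A -> selfadjoint (r%:C *: A).
Proof. by move=> sA x y; rewrite rdotZrl rdotZrr sA. Qed.

Lemma selfadjointN A : selfadjoint A -> selfadjoint (- A).
Proof. by move=> sA x y; rewrite rdotNl rdotNr sA. Qed.

Lemma selfadjointM A B : selfadjoint A -> selfadjoint B -> A * B = B * A ->
  selfadjoint (A * B).
Proof.
by move=> sA sB AB x y; rewrite {2}AB -[LHS]/(rdot (A (B x)) y) sA sB.
Qed.

(** By self-adjointness [rdot (S x) y] is a symmetric form, and representing x |-> [rdot x z] by it
    solves S y = z. Coercivity gives injectivity, hence linearity of the inverse, and the bound
    1/c. *)
Lemma coercive_invertible S (c : R) : selfadjoint S -> 0 < c ->
  (forall x, c * rnorm x ^+ 2 <= rdot (S x) x) ->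
  exists B : bop H, B * S = 1 /\ S * B = 1.
Proof.
move=> sS c0 cS.
have inj z w : S z = S w -> z = w.
  move=> /eqP; rewrite -subr_eq0 -linearB => /eqP h; apply/eqP.
  have := cS (z - w); rewrite h rdot0l pmulr_rle0// => h2.
  by rewrite -subr_eq0 -rnorm_eq0 -sqrf_eq0 eq_le h2 sqr_ge0.
have /choice[B SB] : forall z, exists y, S y = z.
  move=> z.
  have [||||||||||y yP] := @coercive_representation R H (fun x y => rdot (S x) y)
      (fun x => rdot x z) c (opnorm S) (rnorm z).
  - by move=> u v w; rewrite linearD rdotDl.
  - by move=> r u v; rewrite linearZ rdotZrl.
  - by move=> u v; rewrite sS rdotC.
  - exact: c0.
  - exact: cS.
  - exact: opnorm_ge0.
  - move=> u v; rewrite (le_trans (rdot_CS_norm _ _))// mulrA ler_wpM2r//.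
    exact: le_opnorm.
  - by move=> u v; rewrite rdotDl.
  - by move=> r u; rewrite rdotZrl.
  - by move=> u; rewrite mulrC rdot_CS_norm.
  by exists y; apply: rdot_eq => u; rewrite -sS yP.
have linB : linear B.
  by move=> a u v; apply: inj; rewrite (linearP S) /= !SB.
have bB : B \in bounded_pred.
  apply/asboolP; split => //; exists c^-1%:C => u.
  rewrite -!rnormE -rmorphM /= lecR.
  have [->|Bu] := eqVneq (rnorm (B u)) 0; first by rewrite mulr_ge0// invr_ge0 ltW.
  have Bp : 0 < rnorm (B u) by rewrite lt_def Bu /=.
  rewrite mulrC ler_pdivlMr// -(ler_pM2r Bp) mulrAC -expr2 mulrC.
  by rewrite (le_trans (cS _))// SB rdot_CS.
by exists (Bop bB); split; apply: bop_eq => u /=; [apply: inj|]; rewrite SB.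
Qed.

(** A consequence of invertibility that is inherited by products, so it can be followed through the
    linear factors of a polynomial. *)
Definition bounded_below A := exists2 k : R, 0 < k & forall x, k * rnorm x <= rnorm (A x).

Lemma bounded_belowM A B : bounded_below A -> bounded_below B -> bounded_below (A * B).
Proof.
move=> [k k0 kA] [l l0 lB]; exists (k * l); first exact: mulr_gt0.
move=> x; rewrite (le_trans _ (kA _))// -mulrA ler_wpM2l//; exact: ltW.
Qed.

Lemma bounded_belowZ (a : R[i]) A : a != 0 -> bounded_below A -> bounded_below (a *: A).
Proof.
move=> a0 [k k0 kA].
have ap : 0 < rnorm a by rewrite lt_def rnorm_eq0 a0 /=.
exists (rnorm a * k); first exact: mulr_gt0.
by move=> x; rewrite rnormZ -mulrA ler_pM2l.
Qed.

Lemma invertible_bounded_below A B : B * A = 1 -> bounded_below A.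
Proof.
move=> BA; exists (opnorm B + 1)^-1; first by rewrite invr_gt0 ltr_wpDl ?opnorm_ge0.
move=> x; rewrite mulrC ler_pdivrMr ?ltr_wpDl ?opnorm_ge0//.
have {1}-> : x = B (A x) by rewrite -[RHS]/((B * A) x) BA.
rewrite (le_trans (le_opnorm _ _))// mulrC ler_wpM2l// lerDl//.
Qed.

(** For self-adjoint A the real inner product of A x and i x vanishes, so pairing (A - z) x with i x
    leaves only - Im z ||x||^2. *)
Lemma selfadjoint_nonreal_bounded_below A (z : R[i]) : selfadjoint A ->
  complex.Im z != 0 -> bounded_below (A - z *: (1 : bop H)).
Proof.
move=> sA z0; exists `|complex.Im z|; first by rewrite normr_gt0.
move=> x.
have [->|x0] := eqVneq (rnorm x) 0; first by rewrite mulr0.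
have xp : 0 < rnorm x by rewrite lt_def x0 /=.
rewrite -(ler_pM2r xp) -mulrA -expr2.
have -> : rnorm ((A - z *: (1 : bop H)) x) * rnorm x =
    rnorm ((A - z *: (1 : bop H)) x) * rnorm ('i%C *: x).
  have i1 : rnorm ('i%C : R[i]) = 1.
    by rewrite /rnorm normc_def /= expr0n expr1n add0r sqrtr1.
  by rewrite (rnormZ 'i%C x) i1 mul1r.
apply: le_trans (rdot_CS_norm _ _).
have h1 : rdot (A x) ('i%C *: x) = 0.
  have : rdot (A x) ('i%C *: x) = - rdot (A x) ('i%C *: x).
    rewrite {1}sA linearZ /= rdotC rdotZl -rdotNr; congr (rdot _ _).
    rewrite -scaleNr; congr (_ *: _); rewrite /= /real_complex_def; apply/eqP.
    by rewrite eq_complex /= !oppr0 !eqxx.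
  lra.
have h2 : rdot (z *: x) ('i%C *: x) = complex.Im z * rnorm x ^+ 2.
  rewrite -rdotxx /rdot linearZl_LR linearZr_LR /= -normr_inner -rnormE -rmorphXn.
  by case: z {z0} => u v /=; ring.
have -> : rdot ((A - z *: (1 : bop H)) x) ('i%C *: x) = - (complex.Im z * rnorm x ^+ 2).
  by rewrite -[LHS]/(rdot (A x - z *: x) ('i%C *: x)) rdotBl h1 h2 sub0r.
by rewrite normrN normrM (ger0_norm (sqr_ge0 _)).
Qed.

End Adjoint.

(** * Polynomials of a self-adjoint operator and its spectrum *)

Section PolynomialCalculus.
Context {R : realType} {H : hilbertType R}.
Implicit Types (x y z : H) (r : R) (A B C S T : bop H).

Lemma bop_scalerAl (a : R[i]) A B : a *: (A * B) = (a *: A) * B.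
Proof. exact: bop_eq. Qed.

Lemma bop_scalerAr (a : R[i]) A B : a *: (A * B) = A * (a *: B).
Proof. by apply: bop_eq => x /=; rewrite -[RHS]/(A (a *: B x)) linearZ. Qed.

(** Complex coefficients, because the linear factors of a real polynomial may have nonreal roots. *)
Definition cpolyop (p : {poly R[i]}) A : bop H := \sum_(k < size p) p`_k *: A ^+ k.

Lemma cpolyop_widen (p : {poly R[i]}) A n : (size p <= n)%N ->
  cpolyop p A = \sum_(k < n) p`_k *: A ^+ k.
Proof.
move=> pn; rewrite /cpolyop (big_ord_widen _ (fun k => p`_k *: A ^+ k) pn).
rewrite big_mkcond; apply: eq_bigr => k _; case: ltnP => // pk.
by rewrite nth_default// scale0r.
Qed.

Lemma cpolyopD (p q : {poly R[i]}) A : cpolyop (p + q) A = cpolyop p A + cpolyop q A.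
Proof.
pose n := maxn (size p) (size q).
rewrite (@cpolyop_widen (p + q) A n) ?size_polyD//.
rewrite (@cpolyop_widen p A n) ?leq_maxl// (@cpolyop_widen q A n) ?leq_maxr//.
by rewrite -big_split; apply: eq_bigr => k _; rewrite coefD scalerDl.
Qed.

Lemma cpolyop0 A : cpolyop 0 A = 0.
Proof. by rewrite /cpolyop size_poly0 big_ord0. Qed.

Lemma cpolyopC (a : R[i]) A : cpolyop a%:P A = a *: (1 : bop H).
Proof.
by rewrite (@cpolyop_widen _ _ 1) ?size_polyC_leq1// big_ord1 coefC.
Qed.

Lemma cpolyopZ (a : R[i]) (p : {poly R[i]}) A : cpolyop (a *: p) A = a *: cpolyop p A.
Proof.
rewrite (@cpolyop_widen _ _ (size p)) ?size_scale_leq// scaler_sumr.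
by apply: eq_bigr => k _; rewrite coefZ scalerA.
Qed.

Lemma cpolyopN (p : {poly R[i]}) A : cpolyop (- p) A = - cpolyop p A.
Proof. by rewrite -scaleN1r cpolyopZ scaleN1r. Qed.

Lemma cpolyopMX (p : {poly R[i]}) A : cpolyop (p * 'X) A = A * cpolyop p A.
Proof.
rewrite (@cpolyop_widen _ _ (size p).+1); last first.
  by rewrite (leq_trans (size_polyMleq _ _))// size_polyX addn2.
rewrite big_ord_recl coefMX /= scale0r add0r mulr_sumr.
by apply: eq_bigr => k _; rewrite coefMX /= exprS bop_scalerAr.
Qed.

Lemma cpolyop_comm (p : {poly R[i]}) A : cpolyop p A * A = A * cpolyop p A.
Proof.
rewrite mulr_sumr mulr_suml; apply: eq_bigr => k _.
by rewrite -bop_scalerAl -bop_scalerAr -exprS exprSr.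
Qed.

Lemma cpolyopX A : cpolyop 'X A = A.
Proof. by rewrite -['X]mul1r cpolyopMX cpolyopC scale1r mulr1. Qed.

Lemma cpolyopM (p q : {poly R[i]}) A : cpolyop (p * q) A = cpolyop p A * cpolyop q A.
Proof.
elim/poly_ind: p => [|p c IH]; first by rewrite mul0r cpolyop0 mul0r.
rewrite mulrDl -mulrA ['X * q]mulrC mulrA !cpolyopD !cpolyopMX IH mulrDl mulrA.
by congr (_ + _); rewrite mul_polyC cpolyopZ cpolyopC -bop_scalerAl mul1r.
Qed.

Lemma polyopE (p : {poly R}) A : polyop p A = cpolyop (map_poly (real_complex R) p) A.
Proof.
rewrite /polyop /cpolyop size_map_poly; apply: eq_bigr => k _.
by rewrite coef_map.
Qed.

Lemma polyopB (p q : {poly R}) A : polyop (p - q) A = polyop p A - polyop q A.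
Proof. by rewrite !polyopE rmorphB /= cpolyopD cpolyopN. Qed.

Lemma polyopM (p q : {poly R}) A : polyop (p * q) A = polyop p A * polyop q A.
Proof. by rewrite !polyopE rmorphM /= cpolyopM. Qed.

Lemma polyopC r A : polyop r%:P A = r%:C *: (1 : bop H).
Proof. by rewrite polyopE map_polyC cpolyopC. Qed.

Lemma polyopX A : polyop 'X A = A.
Proof. by rewrite polyopE map_polyX cpolyopX. Qed.

Lemma polyop_selfadjoint (p : {poly R}) A : selfadjoint A -> selfadjoint (polyop p A).
Proof.
move=> sA; elim/poly_ind: p => [|p c IH].
  by rewrite polyopE rmorph0 cpolyop0 => x y; rewrite [LHS]rdot0l [RHS]rdotC [RHS]rdot0l.
rewrite polyopE rmorphD rmorphM /= map_polyX map_polyC cpolyopD cpolyopMX -polyopE.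
rewrite cpolyopC; apply: selfadjointD; last exact/selfadjointZ/selfadjoint1.
by apply: selfadjointM => //; rewrite polyopE cpolyop_comm.
Qed.

Lemma polyop_intertwine (p : {poly R}) A B C : C * A = B * C ->
  C * polyop p A = polyop p B * C.
Proof.
move=> CAB; rewrite mulr_sumr mulr_suml; apply: eq_bigr => k _.
rewrite -bop_scalerAl -bop_scalerAr; congr (_ *: _).
elim: (nat_of_ord k) => [|n IH]; first by rewrite !expr0 mul1r mulr1.
by rewrite !exprS mulrA CAB -mulrA IH mulrA.
Qed.

End PolynomialCalculus.

(** * Spectral bound for the norm of a polynomial in a self-adjoint operator *)

Section SpectralNorm.
Context {R : realType} {H : hilbertType R}.
Implicit Types (x y z : H) (r : R) (A B C S T : bop H).

(** Every linear factor is bounded below: at a nonreal root by self-adjointness, at a real root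
    because it lies outside the spectrum. *)
Lemma cpolyop_bounded_below (p : {poly R[i]}) A : selfadjoint A -> p != 0 ->
  (forall t : R, root p t%:C -> ~ spectrum A t%:C) ->
  bounded_below (cpolyop p A).
Proof.
move=> sA p0 pA.
have [s ps] := closed_field_poly_normal p.
have l0 : lead_coef p != 0 by rewrite lead_coef_eq0.
rewrite ps cpolyopZ; apply: bounded_belowZ => //.
have {pA ps} : forall z : R[i], z \in s -> bounded_below (A - z *: (1 : bop H)).
  move=> z zs.
  have pz : root p z by rewrite ps rootZ// root_prod_XsubC.
  have [iz|] := eqVneq (complex.Im z) 0; last exact: selfadjoint_nonreal_bounded_below.
  have zE : z = (complex.Re z)%:C by case: z iz {zs pz} => u v /= ->.
  move: pz; rewrite zE => /pA /contrapT[B [BA _]].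
  exact: invertible_bounded_below BA.
elim: s => [|z s IH] sb.
  by rewrite big_nil cpolyopC scale1r; exists 1 => // x; rewrite mul1r.
rewrite big_cons cpolyopM; apply: bounded_belowM.
  by rewrite cpolyopD cpolyopX cpolyopN cpolyopC; apply: sb; rewrite mem_head.
by apply: IH => w ws; apply: sb; rewrite in_cons ws orbT.
Qed.

(* ||S^2 x - nu^2 x||^2 <= nu^2 (nu^2 ||x||^2 - ||S x||^2) for nu = ||S||, so
   near-maximisers of ||S x|| are approximate eigenvectors of S^2. *)
Lemma opnorm_not_bounded_below S x0 : selfadjoint S -> x0 != 0 ->
  ~ bounded_below (S * S - (opnorm S ^+ 2)%:C *: (1 : bop H)).
Proof.
move=> sS x00 [k k0]; set nu := opnorm S => kS.
have nu0 : 0 <= nu := opnorm_ge0 S.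
have main x : k ^+ 2 * rnorm x ^+ 2 + nu ^+ 2 * rnorm (S x) ^+ 2 <= nu ^+ 4 * rnorm x ^+ 2.
  have h1 : (k * rnorm x) ^+ 2 <= rnorm ((S * S - (nu ^+ 2)%:C *: (1 : bop H)) x) ^+ 2.
    by rewrite ler_pXn2r// ?nnegrE// mulr_ge0// ltW.
  have h2 : rnorm ((S * S - (nu ^+ 2)%:C *: (1 : bop H)) x) ^+ 2
     = rnorm (S (S x)) ^+ 2 + nu ^+ 4 * rnorm x ^+ 2 - 2 * nu ^+ 2 * rnorm (S x) ^+ 2.
    rewrite -[(S * S - _) x]/(S (S x) - (nu ^+ 2)%:C *: x) -rdotxx.
    have SSx : rdot (S (S x)) x = rnorm (S x) ^+ 2 by rewrite sS rdotxx.
    rewrite !(rdotBl, rdotBr, rdotZrl, rdotZrr) (rdotC x (S (S x))) SSx !rdotxx; ring.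
  have h3 : rnorm (S (S x)) ^+ 2 <= (nu * rnorm (S x)) ^+ 2.
    by rewrite ler_pXn2r// ?nnegrE// ?mulr_ge0// le_opnorm.
  move: h1 h3; rewrite h2 !exprMn; lra.
have {nu0} nup : 0 < nu.
  rewrite lt_def nu0 andbT; apply/eqP => nuE.
  have := main x0; rewrite nuE !expr0n /= !mul0r addr0 => h.
  have : 0 < k ^+ 2 * rnorm x0 ^+ 2.
    by rewrite mulr_gt0// exprn_gt0// lt_def rnorm_eq0 x00 /=.
  by rewrite ltNge h.
(* Divided by [nu ^+ 2], [main] reads ||S x||^2 <= q ||x||^2, which gives nu <= sqrt q although q <
   nu^2. The sign of [q] is open at first, but [Num.sqrt] is 0 on negative numbers and nu > 0. *)
pose q := nu ^+ 2 - k ^+ 2 / nu ^+ 2.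
have Sq x : rnorm (S x) <= Num.sqrt q * rnorm x.
  have -> : rnorm (S x) = Num.sqrt (rnorm (S x) ^+ 2) by rewrite sqrtr_sqr ger0_norm.
  have -> : Num.sqrt q * rnorm x = Num.sqrt (rnorm x ^+ 2 * q).
    by rewrite sqrtrM ?sqr_ge0// sqrtr_sqr ger0_norm// mulrC.
  apply: ler_wsqrtr; rewrite -(ler_pM2l (exprn_gt0 2 nup)).
  have -> : nu ^+ 2 * (rnorm x ^+ 2 * q) = nu ^+ 4 * rnorm x ^+ 2 - k ^+ 2 * rnorm x ^+ 2.
    by rewrite /q; field; rewrite gt_eqF.
  have := main x; lra.
have := opnorm_le (sqrtr_ge0 _) Sq; rewrite -/nu => nuq.
have qp : 0 < q by rewrite -sqrtr_gt0 (lt_le_trans nup).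
have : nu ^+ 2 <= q.
  by rewrite -(sqr_sqrtr (ltW qp)) ler_pXn2r// nnegrE ?sqrtr_ge0// ltW.
rewrite /q lerBrDr gerDl => h.
have : 0 < k ^+ 2 / nu ^+ 2 by rewrite divr_gt0// exprn_gt0.
by rewrite ltNge h.
Qed.

Lemma spectrum_norm_attained A (p : {poly R}) x0 : selfadjoint A -> x0 != 0 ->
  p ^+ 2 != (opnorm (polyop p A) ^+ 2)%:P ->
  exists2 t : R, spectrum A t%:C & p.[t] ^+ 2 = opnorm (polyop p A) ^+ 2.
Proof.
move=> sA x00; set nu := opnorm _ => pnu.
apply: contrapT => noroot.
have sp := polyop_selfadjoint p sA.
apply: (opnorm_not_bounded_below sp x00); rewrite -/nu.
have -> : polyop p A * polyop p A - (nu ^+ 2)%:C *: (1 : bop H) =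
    polyop (p ^+ 2 - (nu ^+ 2)%:P) A.
  by rewrite polyopB polyopC expr2 polyopM.
rewrite polyopE; apply: cpolyop_bounded_below => //.
  by rewrite map_poly_eq0 subr_eq0.
move=> t; rewrite fmorph_root => /rootP; rewrite !hornerE => h At.
by apply: noroot; exists t => //; apply/eqP; rewrite -subr_eq0 h.
Qed.

Lemma polyop_bound A (p : {poly R}) (c : R) : selfadjoint A -> 0 <= c ->
  (forall t : R, spectrum A t%:C -> `|p.[t]| <= c) -> opnorm (polyop p A) <= c.
Proof.
move=> sA c0 pc.
(* On the zero space the spectrum is empty, so the hypothesis gives no bound, but every operator
   norm is 0. *)
have [[x0 x00]|H0] := pselect (exists x0 : H, x0 != 0); last first.
  apply: opnorm_le => // x.
  have -> : x = 0 by apply/eqP/negP => /negP x0; apply: H0; exists x.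
  by rewrite linear0 rnorm0 mulr0.
suff [t At pt] : exists2 t : R, spectrum A t%:C & p.[t] ^+ 2 = opnorm (polyop p A) ^+ 2.
  rewrite (le_trans _ (pc _ At))//.
  by rewrite -(ler_pXn2r (n := 2))// ?nnegrE ?opnorm_ge0// real_normK ?num_real// pt.
(* If p^2 is the constant nu^2, every point of the spectrum attains the norm; the same lemma applied
   to 'X shows that there is one. *)
have [pnu|] := eqVneq (p ^+ 2) (opnorm (polyop p A) ^+ 2)%:P; last first.
  exact: spectrum_norm_attained x00.
have [|t At _] := @spectrum_norm_attained A 'X x0 sA x00.
  apply/eqP => /(congr1 (fun q : {poly R} => size q)).
  by rewrite size_polyXn size_polyC; case: (_ != 0).
by exists t => //; rewrite -horner_exp pnu hornerC.
Qed.

(** For t < 0 the operator A - t is coercive, for t > ||A|| the operator t - A is. *)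
Lemma positive_spectrum A (t : R) : positive A -> spectrum A t%:C -> 0 <= t <= opnorm A.
Proof.
move=> [sA A0] At.
have AtE x : (A - t%:C *: (1 : bop H)) x = A x - t%:C *: x by [].
have sAt : selfadjoint (A - t%:C *: (1 : bop H)).
  by apply: selfadjointD => //; apply/selfadjointN/selfadjointZ/selfadjoint1.
apply/andP; split; rewrite leNgt; apply/negP => tlt; apply: At.
  apply: (@coercive_invertible _ _ _ (- t)) => //; first by rewrite oppr_gt0.
  by move=> x; rewrite AtE rdotBl rdotZrl rdotxx; have := A0 x; lra.
have [||B [BA AB]] := @coercive_invertible _ _ _ (t - opnorm A) (selfadjointN sAt).
- by rewrite subr_gt0.
- move=> x; rewrite -[X in rdot X _]/(- (A x - t%:C *: x)) rdotNl rdotBl rdotZrl rdotxx.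
  have := rdot_CS (A x) x; have := ler_wpM2r (rnorm_ge0 x) (le_opnorm A x).
  rewrite -mulrA -expr2; lra.
by exists (- B); rewrite mulNr mulrN in BA AB *; rewrite mulNr mulrN.
Qed.

End SpectralNorm.

(** * Weierstrass approximation *)

Section Weierstrass.
Context {R : realType}.
Implicit Types (f F G : nat -> R) (t : R).

Lemma heine_cantor_segment (f : R -> R) (M : R) :
  {within `[0, M], continuous f} -> forall e : R, 0 < e ->
  exists2 d : R, 0 < d & forall s t, 0 <= s <= M -> 0 <= t <= M ->
    `|s - t| < d -> `|f s - f t| < e.
Proof.
move=> /subspace_continuousP cf e e0.
have cK := @segment_compact R 0 M.
move/compact_near_coveringP/near_covering_withinP : cK => cK.
(* The modulus [d] is the parameter of the covering: what holds near each x for small [d] holds on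
   the whole segment for some [d]. *)
have {}cK := cK R 0^'+ (fun d s => forall t, 0 <= t <= M -> `|s - t| < d -> `|f s - f t| < e) _.
have : \forall d \near 0^'+, `[0, M] `<=`
    (fun s => forall t, 0 <= t <= M -> `|s - t| < d -> `|f s - f t| < e).
  apply: cK => x xM.
  have /cvgrPdist_lt/(_ (e / 2)) := cf x xM.
  rewrite divr_gt0// => /(_ isT) [d /= d0 dP].
  have d20 : 0 < d / 2 by rewrite divr_gt0.
  (* With y within d/2 of x and t within d/2 of y, both y and t are within d of x. *)
  exists ([set y | `|x - y| < d / 2], [set c | c < d / 2]) => /=.
    split; first by exists (d / 2).
    exact: nbhs_right_lt.
  move=> [y c] /= [xy cd] yM t tM yt.
  have h1 : `|f x - f y| < e / 2 by apply: dP => //=; lra.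
  have h2 : `|f x - f t| < e / 2.
    apply: dP; last by rewrite /= in_itv.
    rewrite /= (_ : x - t = (x - y) + (y - t)); last by ring.
    by rewrite (le_lt_trans (ler_normD _ _))//; lra.
  rewrite (_ : f y - f t = (f x - f t) - (f x - f y)); last by ring.
  by rewrite (le_lt_trans (ler_normB _ _))//; lra.
move=> hd; near (0 : R)^'+ => d.
exists d => // s t sM tM st.
have : `[0, M] `<=` (fun s => forall t, 0 <= t <= M -> `|s - t| < d -> `|f s - f t| < e) by near: d.
by apply => //=; rewrite in_itv.
Unshelve. all: by end_near. Qed.

Lemma bounded_on_segment (f : R -> R) (M : R) : 0 <= M ->
  {within `[0, M], continuous f} ->
  exists2 B : R, 0 <= B & forall t, 0 <= t <= M -> `|f t| <= B.
Proof.
move=> M0 cf.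
have cnf : {within `[0, M], continuous (fun t => - f t)}.
  by move=> x; apply: continuousN; exact: cf.
have [c _ cP] := EVT_max M0 cf; have [c' _ cP'] := EVT_max M0 cnf.
exists (`|f c| + `|f c'|) => [|t tM]; first by rewrite addr_ge0.
have := cP t; have := cP' t; rewrite in_itv /= => /(_ tM) h1 /(_ tM) h2.
have := ler_norm (f c); have := ler_norm (- f c'); rewrite normrN.
have := normr_ge0 (f c); have := normr_ge0 (f c').
by rewrite ler_norml => *; apply/andP; split; lra.
Qed.

(** At distance at least d, the trivial bound 2 B is below (2 B / d^2) (s - t)^2. A quadratic
    modulus is chosen because Bernstein polynomials of squares have a closed form. *)
Lemma quadratic_modulus (f : R -> R) (M : R) : 0 <= M ->
  {within `[0, M], continuous f} -> forall e : R, 0 < e ->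
  exists2 K : R, 0 <= K & forall s t, 0 <= s <= M -> 0 <= t <= M ->
    `|f s - f t| <= e + K * (s - t) ^+ 2.
Proof.
move=> M0 cf e e0.
have [d d0 dP] := heine_cantor_segment cf e0.
have [B B0 BP] := bounded_on_segment M0 cf.
exists (2 * B / d ^+ 2) => [|s t sM tM]; first by rewrite !mulr_ge0// invr_ge0 sqr_ge0.
have K0 : 0 <= 2 * B / d ^+ 2 by rewrite !mulr_ge0// invr_ge0 sqr_ge0.
have [st|st] := ltP `|s - t| d.
  rewrite (le_trans (ltW (dP _ _ sM tM st)))// lerDl mulr_ge0//; exact: sqr_ge0.
rewrite (le_trans (ler_normB _ _))//.
have : 2 * B / d ^+ 2 * d ^+ 2 <= 2 * B / d ^+ 2 * (s - t) ^+ 2.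
  by rewrite ler_wpM2l// -[leRHS]real_normK ?num_real// ler_pXn2r// nnegrE// ltW.
rewrite divfK ?sqrf_eq0 ?gt_eqF// => h.
by have := BP _ sM; have := BP _ tM; lra.
Qed.

(* The Bernstein polynomial of degree n of the values F 0, ..., F n, computed as
   the expectation of F along n steps of a Bernoulli(X) walk. *)
Fixpoint bernstein (n : nat) (F : nat -> R) : {poly R} :=
  if n is m.+1 then (1 - 'X) * bernstein m F + 'X * bernstein m (F \o succn)
  else (F 0%N)%:P.

Lemma bernsteinS n F t : (bernstein n.+1 F).[t] =
  (1 - t) * (bernstein n F).[t] + t * (bernstein n (F \o succn)).[t].
Proof. by rewrite /= !hornerE. Qed.

Lemma bernstein_le n F G t : 0 <= t <= 1 ->
  (forall k, (k <= n)%N -> F k <= G k) -> (bernstein n F).[t] <= (bernstein n G).[t].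
Proof.
move=> t01; elim: n F G => [|n IH] F G FG; first by rewrite !hornerC FG.
rewrite !bernsteinS lerD// ler_wpM2l ?IH//; try lra.
- by move=> k kn; rewrite FG// leqW.
- by move=> k kn; rewrite FG.
Qed.

Lemma bernstein_affine n (a b : R) F t :
  (bernstein n (fun k => a + b * F k)).[t] = a + b * (bernstein n F).[t].
Proof.
elim: n F => [|n IH] F; first by rewrite !hornerC.
by rewrite !bernsteinS IH (IH (F \o succn)); ring.
Qed.

(** The second moment about c of a binomial variable: variance plus squared bias. The shift in the
    recursion replaces c by c - 1, so c stays general in the induction. *)
Lemma bernstein_sqr n (c t : R) :
  (bernstein n (fun k => (k%:R - c) ^+ 2)).[t] = n%:R * t * (1 - t) + (n%:R * t - c) ^+ 2.
Proof.
elim: n c => [|n IH] c; first by rewrite hornerC; ring.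
rewrite bernsteinS IH.
rewrite (_ : _ \o succn = (fun k => (k%:R - (c - 1)) ^+ 2)); last first.
  by apply/funext => k /=; rewrite -natr1; ring.
by rewrite IH -natr1; ring.
Qed.

Lemma weierstrass_segment (f : R -> R) (M : R) : 0 < M ->
  {within `[0, M], continuous f} -> forall e : R, 0 < e ->
  exists p : {poly R}, forall t, 0 <= t <= M -> `|f t - p.[t]| <= e.
Proof.
move=> M0 cf e e0.
have [|K K0 KP] := quadratic_modulus (ltW M0) cf (e := e / 2); first by rewrite divr_gt0.
have KM : 0 < K * M ^+ 2 + 1.
  by have := mulr_ge0 K0 (sqr_ge0 M); lra.
(* [n] is chosen to make K M^2 / n at most e / 2. *)
have [|N] := @ltr_add_invr R 0 (e / 2 / (K * M ^+ 2 + 1)).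
  by rewrite !divr_gt0.
rewrite add0r ltr_pdivlMr//.
set n := N.+1 => Nn.
have n0 : 0 < n%:R :> R by rewrite ltr0Sn.
pose F k := f (M * k%:R / n%:R).
exists (bernstein n F \Po (M^-1 *: 'X)) => t tM.
rewrite horner_comp hornerZ hornerX; set s := M^-1 * t.
have s01 : 0 <= s <= 1.
  by rewrite /s mulrC ler_pdivrMr// mul1r; case/andP: tM => t0 ->; rewrite divr_ge0// ltW.
have tE : t = M * s by rewrite /s mulVKf// gt_eqF.
have bnd k : (k <= n)%N -> `|f t - F k| <=
    e / 2 + (K * M ^+ 2 / n%:R ^+ 2) * (k%:R - n%:R * s) ^+ 2.
  move=> kn; rewrite (le_trans (KP _ _ tM _))//.
    apply/andP; split; last by rewrite ler_pdivrMr// ler_pM2l// ler_nat.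
    by rewrite divr_ge0// mulr_ge0// ltW.
  rewrite lerD2l le_eqVlt; apply/orP; left; apply/eqP.
  by rewrite tE; field; rewrite gt_eqF.
(* Monotonicity transfers [bnd] to the polynomials; centring the square at n s removes the bias and
   leaves the variance n s (1 - s). *)
have up : (bernstein n F).[s] <= f t + (e / 2 + K * M ^+ 2 / n%:R * (s * (1 - s))).
  have := @bernstein_le n F (fun k => (f t + e / 2) +
    (K * M ^+ 2 / n%:R ^+ 2) * (k%:R - n%:R * s) ^+ 2) s s01.
  rewrite bernstein_affine bernstein_sqr => /(_ _) h; apply: le_trans (h _) _.
    by move=> k /bnd; rewrite ler_norml => /andP[+ _]; lra.
  rewrite le_eqVlt; apply/orP; left; apply/eqP; field; rewrite gt_eqF//.
have lo : f t - (e / 2 + K * M ^+ 2 / n%:R * (s * (1 - s))) <= (bernstein n F).[s].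
  have := @bernstein_le n (fun k => (f t - e / 2) +
    (- (K * M ^+ 2 / n%:R ^+ 2)) * (k%:R - n%:R * s) ^+ 2) F s s01.
  rewrite bernstein_affine bernstein_sqr => /(_ _) h; apply: le_trans (h _).
    rewrite le_eqVlt; apply/orP; left; apply/eqP; field; rewrite gt_eqF//.
  by move=> k /bnd; rewrite ler_norml => /andP[_ +]; lra.
have : K * M ^+ 2 / n%:R * (s * (1 - s)) <= e / 2.
  apply: (@le_trans _ _ (K * M ^+ 2 / n%:R)).
    rewrite ler_piMr ?mulr_ge0 ?invr_ge0 ?sqr_ge0 ?(ltW n0)//; nra.
  have : 0 < n%:R^-1 :> R by rewrite invr_gt0.
  lra.
by rewrite ler_norml => h; apply/andP; split; lra.
Qed.

End Weierstrass.

(** * Continuous functional calculus *)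

Section FunctionalCalculus.
Context {R : realType} {H : hilbertType R}.
Implicit Types (x y z : H) (f g : R -> R) (A B C : bop H).

(** The restriction d <= 1 lets errors of order d^2 be absorbed into those of order d. *)
Lemma le0_of_small (a K : R) : (forall d : R, 0 < d <= 1 -> a <= d * K) -> a <= 0.
Proof.
move=> aK; apply/ler_addgt0Pl => e e0; rewrite addr0.
have K1 : 0 < `|K| + 1 by rewrite ltr_wpDl.
have eK : 0 < e / (`|K| + 1) by rewrite divr_gt0.
pose d := Num.min 1 (e / (`|K| + 1)).
have d0 : 0 < d by rewrite lt_min ltr01 eK.
have d1 : d <= 1 by rewrite ge_min lexx.
have de : d <= e / (`|K| + 1) by rewrite ge_min lexx orbT.
rewrite (le_trans (aK d _)) ?d0//.
rewrite (le_trans (ler_wpM2l (ltW d0) (ler_norm K)))//.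
move: de; rewrite ler_pdivlMr//; lra.
Qed.

Lemma opnorm_small_eq A B (K : R) :
  (forall d : R, 0 < d <= 1 -> opnorm (A - B) <= d * K) -> A = B.
Proof.
by move=> AB; apply/eqP; rewrite -subr_eq0; apply/eqP/opnorm0_eq/(le0_of_small AB).
Qed.

Local Notation continuous_ge0 f := {within `[0, +oo[, continuous f}.

Lemma continuous_ge0_segment f (M : R) : continuous_ge0 f -> {within `[0, M], continuous f}.
Proof.
by apply: continuous_subspaceW => t /=; rewrite !in_itv /= => /andP[->].
Qed.

Lemma continuous_ge0M f g : continuous_ge0 f -> continuous_ge0 g ->
  continuous_ge0 (fun t => f t * g t).
Proof. by move=> cf cg x; apply: continuousM; [exact: cf|exact: cg]. Qed.

Lemma weierstrass_ge0 f (M d : R) : continuous_ge0 f -> 0 < d ->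
  exists q : {poly R}, forall t, 0 <= t <= M -> `|f t - q.[t]| <= d.
Proof.
move=> cf d0.
have M0 : 0 < `|M| + 1 by rewrite ltr_wpDl.
have [q qP] := weierstrass_segment M0 (continuous_ge0_segment (M := `|M| + 1) cf) d0.
exists q => t /andP[t0 tM]; apply: qP; rewrite t0 /=.
by have := ler_norm M; lra.
Qed.

Definition is_cfc f A B := forall e : R, 0 < e -> exists p : {poly R},
  (forall t : R, spectrum A t%:C -> `|f t - p.[t]| < e) /\ opnorm (B - polyop p A) < e.

(** The interval [0, ||A||] contains the spectrum, so [polyop_bound] makes uniformly convergent
    polynomials Cauchy in operator norm. *)
Lemma cfc_exists f A : positive A -> continuous_ge0 f -> exists B, is_cfc f A B.
Proof.
move=> pA cf.
have /choice[q qP] : forall n : nat, exists q : {poly R},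
    forall t, 0 <= t <= opnorm A -> `|f t - q.[t]| <= n.+1%:R^-1.
  by move=> n; apply: weierstrass_ge0 => //; rewrite invr_gt0 ltr0Sn.
have [e e0|L LP] := @bop_complete _ _ (fun n => polyop (q n) A).
  have [|N NP] := @exists_invS_lt _ (e / 2); first by rewrite divr_gt0.
  exists N => m n Nm Nn; rewrite -polyopB; apply: polyop_bound; [exact: pA.1|exact: ltW|].
  move=> t /(positive_spectrum pA) tA; rewrite hornerD hornerN.
  rewrite (_ : _ - _ = (f t - (q n).[t]) - (f t - (q m).[t])); last by ring.
  rewrite (le_trans (ler_normB _ _))//.
  have := qP m t tA; have := qP n t tA; have := NP _ Nm; have := NP _ Nn.
  move: n.+1%:R^-1 m.+1%:R^-1 => *; lra.
exists L => e e0.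
have e20 : 0 < e / 2 by rewrite divr_gt0.
have [N NP] := @exists_invS_lt _ e e0.
have [N' NP'] := LP _ e20.
exists (q (maxn N N')); split.
  move=> t /(positive_spectrum pA) tA.
  by rewrite (le_lt_trans (qP _ _ tA))// NP// leq_maxl.
rewrite opnormB (le_lt_trans (NP' _ (leq_maxr _ _)))//; lra.
Qed.

Lemma cfcP f A : positive A -> continuous_ge0 f -> is_cfc f A (cfc f A).
Proof.
by move=> pA cf; apply: (@xgetPex _ 0 (is_cfc f A)); exact: cfc_exists.
Qed.

(** Compare both operators with a polynomial provided by the definition; the bound holds for
    whichever operator the choice in [cfc] returns. *)
Lemma cfc_dist_polyop f A (q : {poly R}) (e : R) : positive A -> continuous_ge0 f ->
  0 <= e -> (forall t, 0 <= t <= opnorm A -> `|f t - q.[t]| <= e) ->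
  opnorm (cfc f A - polyop q A) <= e.
Proof.
move=> pA cf e0 fq; apply/ler_addgt0Pl => d d0.
have [|p [fp Ap]] := @cfcP f A pA cf (d / 2); first by rewrite divr_gt0.
rewrite (le_trans (opnorm_dist _ (polyop p A) _))// -polyopB.
have : opnorm (polyop (p - q) A) <= d / 2 + e.
  apply: polyop_bound; [exact: pA.1|by lra|].
  move=> t At; rewrite hornerD hornerN.
  rewrite (_ : _ - _ = (f t - q.[t]) - (f t - p.[t])); last by ring.
  rewrite (le_trans (ler_normB _ _))// addrC lerD// ?fq ?positive_spectrum//.
  exact/ltW/fp.
lra.
Qed.

(** A single [q] serves all positive operators of norm at most M, which is what allows [cfc f A] and
    [cfc f B] to be compared in [cfc_intertwine]. *)
Lemma cfc_approx f A (M d : R) : positive A -> continuous_ge0 f -> opnorm A <= M -> 0 < d ->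
  exists q : {poly R}, (forall t, 0 <= t <= M -> `|f t - q.[t]| <= d) /\
    forall B, positive B -> opnorm B <= M -> opnorm (cfc f B - polyop q B) <= d.
Proof.
move=> pA cf AM d0; have [q qP] := weierstrass_ge0 M cf d0.
exists q; split => // B pB BM; apply: cfc_dist_polyop => //; first exact: ltW.
by move=> t /andP[t0 tB]; rewrite qP// t0 (le_trans tB).
Qed.

Lemma eq_cfc f g A : positive A -> (forall t, 0 <= t -> f t = g t) -> cfc f A = cfc g A.
Proof.
move=> pA fg; rewrite /cfc; congr (xget _ _); apply/seteqP.
by split => B hB e e0; have [p [fp Bp]] := hB e e0; exists p; split=> // t At;
  have := fp t At; rewrite fg//; have /andP[] := positive_spectrum pA At.
Qed.

Lemma cfc_id A : positive A -> cfc id A = A.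
Proof.
move=> pA; apply/eqP; rewrite -subr_eq0; apply/eqP/opnorm0_eq.
rewrite -{2}(polyopX A); apply: cfc_dist_polyop => //.
  by apply: continuous_subspaceT => x; exact: cvg_id.
by move=> t _; rewrite hornerX subrr normr0.
Qed.

Lemma cfc_selfadjoint f A : positive A -> continuous_ge0 f -> selfadjoint (cfc f A).
Proof.
move=> pA cf x y; apply/eqP; rewrite -subr_eq0 -normr_eq0 eq_le normr_ge0 andbT.
apply: (@le0_of_small _ (2 * (rnorm x * rnorm y))) => d /andP[d0 _].
have [q [_ /(_ A pA (lexx _)) Fq]] := cfc_approx pA cf (lexx _) d0.
pose D := cfc f A - polyop q A.
have FD z : cfc f A z = D z + polyop q A z by rewrite -[RHS]/((D + polyop q A) z) subrK.
rewrite !FD rdotDl rdotDr (polyop_selfadjoint q pA.1) opprD addrACA subrr addr0.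
have D1 : `|rdot (D x) y| <= d * (rnorm x * rnorm y).
  rewrite (le_trans (rdot_CS_norm _ _))// mulrA ler_wpM2r//.
  by rewrite (le_trans (le_opnorm _ _))// ler_wpM2r.
have D2 : `|rdot x (D y)| <= d * (rnorm x * rnorm y).
  rewrite (le_trans (rdot_CS_norm _ _))// mulrCA ler_wpM2l//.
  by rewrite (le_trans (le_opnorm _ _))// ler_wpM2r.
by rewrite (le_trans (ler_normB _ _))//; lra.
Qed.

Lemma cfc_intertwine f A B C : positive A -> positive B -> continuous_ge0 f ->
  C * A = B * C -> C * cfc f A = cfc f B * C.
Proof.
move=> pA pB cf CAB; apply: (@opnorm_small_eq _ _ (2 * opnorm C)) => d /andP[d0 _].
have AM : opnorm A <= opnorm A + opnorm B by rewrite lerDl opnorm_ge0.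
have BM : opnorm B <= opnorm A + opnorm B by rewrite lerDr opnorm_ge0.
have [q [_ qP]] := cfc_approx pA cf AM d0.
have -> : C * cfc f A - cfc f B * C =
    C * (cfc f A - polyop q A) + (polyop q B - cfc f B) * C.
  by rewrite mulrBr mulrBl (polyop_intertwine _ CAB) addrA subrK.
rewrite (le_trans (opnormD _ _))//.
have := opnormM C (cfc f A - polyop q A); have := opnormM (polyop q B - cfc f B) C.
have := ler_wpM2l (opnorm_ge0 C) (qP A pA AM).
have := ler_wpM2r (opnorm_ge0 C) (qP B pB BM).
rewrite (opnormB (polyop q B)); lra.
Qed.

Lemma cfcM f g A : positive A -> continuous_ge0 f -> continuous_ge0 g ->
  cfc f A * cfc g A = cfc (fun t => f t * g t) A.
Proof.
move=> pA cf cg; set F := cfc f A; set G := cfc g A; set FG := cfc _ A.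
have A0 := opnorm_ge0 A.
have [K K0 KP] := bounded_on_segment A0 (continuous_ge0_segment cf).
have [L L0 LP] := bounded_on_segment A0 (continuous_ge0_segment cg).
(* The sum of the factors of d in [h1] (error of the functions) and [h2] (error of the
   operators). *)
apply: (@opnorm_small_eq _ _ (opnorm G + opnorm F + K + L + 2)) => d /andP[d0 d1].
have [p [fp /(_ A pA (lexx _)) Fp]] := cfc_approx pA cf (lexx _) d0.
have [q [gq /(_ A pA (lexx _)) Gq]] := cfc_approx pA cg (lexx _) d0.
have h1 : opnorm (FG - polyop (p * q) A) <= d * (K + L + 1).
  apply: cfc_dist_polyop => //; first exact: continuous_ge0M.
    by rewrite mulr_ge0 ?ltW//; lra.
  move=> t tA; rewrite hornerM.
  have -> : f t * g t - p.[t] * q.[t] =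
      f t * (g t - q.[t]) + (f t - p.[t]) * g t - (f t - p.[t]) * (g t - q.[t]) by ring.
  rewrite (le_trans (ler_normB _ _))//.
  have := ler_normD (f t * (g t - q.[t])) ((f t - p.[t]) * g t).
  rewrite !normrM.
  have := ler_pM (normr_ge0 _) (normr_ge0 _) (KP t tA) (gq t tA).
  have := ler_pM (normr_ge0 _) (normr_ge0 _) (fp t tA) (LP t tA).
  have := ler_pM (normr_ge0 _) (normr_ge0 _) (fp t tA) (gq t tA).
  have : d * d <= d by rewrite -[leRHS]mulr1 ler_wpM2l// ltW.
  lra.
have h2 : opnorm (F * G - polyop (p * q) A) <= d * (opnorm G + opnorm F + 1).
  have -> : F * G - polyop (p * q) A =
      F * (G - polyop q A) + (F - polyop p A) * G - (F - polyop p A) * (G - polyop q A).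
    by rewrite polyopM -addrA -mulrBr subKr mulrBr mulrBl addrA subrK.
  rewrite (le_trans (opnormD _ _))// opnormN.
  have := opnormD (F * (G - polyop q A)) ((F - polyop p A) * G).
  have := opnormM F (G - polyop q A).
  have := opnormM (F - polyop p A) G.
  have := opnormM (F - polyop p A) (G - polyop q A).
  have := ler_wpM2l (opnorm_ge0 F) Gq.
  have := ler_wpM2r (opnorm_ge0 G) Fp.
  have := ler_pM (opnorm_ge0 _) (opnorm_ge0 _) Fp Gq.
  have : d * d <= d by rewrite -[leRHS]mulr1 ler_wpM2l// ltW.
  lra.
rewrite (le_trans (opnorm_dist _ (polyop (p * q) A) _))// (opnormB _ FG); lra.
Qed.

End FunctionalCalculus.

(** * Mixed Schwarz inequality *)

Section MixedSchwarz.
Context {R : realType} {H : hilbertType R}.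
Implicit Types (x y z : H) (f g : R -> R) (A T : bop H).

Lemma sqrt_continuous_ge0 : {within `[0, +oo[, continuous (@Num.sqrt R)}.
Proof. exact/continuous_subspaceT/sqrt_continuous. Qed.

Lemma cfc_sqrt_sqr A : positive A -> cfc Num.sqrt A * cfc Num.sqrt A = A.
Proof.
move=> pA; rewrite cfcM//; try exact: sqrt_continuous_ge0.
rewrite -[RHS](cfc_id pA); apply: eq_cfc => // t t0.
by rewrite -expr2 sqr_sqrtr.
Qed.

Lemma cfc_sqrt_positive A : positive A -> positive (cfc Num.sqrt A).
Proof.
move=> pA; split; first exact/cfc_selfadjoint/sqrt_continuous_ge0.
have c4 : {within `[0, +oo[, continuous (fun t : R => Num.sqrt (Num.sqrt t))}.
  apply: continuous_subspaceT => t.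
  by apply: continuous_comp; exact: sqrt_continuous.
(* The fourth root exhibits the square root as the square of a self-adjoint operator. *)
move=> x; set Q := cfc (fun t => Num.sqrt (Num.sqrt t)) A.
have -> : cfc Num.sqrt A = Q * Q.
  by rewrite cfcM//; apply: eq_cfc => // t t0; rewrite -expr2 sqr_sqrtr// sqrtr_ge0.
rewrite -[(Q * Q) x]/(Q (Q x)) (cfc_selfadjoint pA c4) rdotxx.
exact: sqr_ge0.
Qed.

Lemma absop_positive T : positive (absop T).
Proof. exact/cfc_sqrt_positive/positive_adjointM. Qed.

Lemma absopM T : absop T * absop T = adjoint T * T.
Proof. exact/cfc_sqrt_sqr/positive_adjointM. Qed.

(** T intertwines T^* T with T T^*, hence also their square roots; this moves functions of |T|
    across T, where they become functions of |T^*|. *)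
Lemma absop_intertwine T : T * absop T = absop (adjoint T) * T.
Proof.
apply: cfc_intertwine; try exact: positive_adjointM.
  exact: sqrt_continuous_ge0.
by rewrite adjointK mulrA.
Qed.

Lemma rnorm_absop T x : rnorm (absop T x) = rnorm (T x).
Proof.
apply/eqP; rewrite -(eqrXn2 (n := 2))// -!rdotxx (absop_positive T).1.
by rewrite -[absop T (absop T x)]/((absop T * absop T) x) absopM -adjoint_rdot.
Qed.

(* Kato's inequality. For r = (|T| + d)^-1, the operator T r is a contraction and
   T |T| r = g(|T^*|) (T r) f(|T|); then let d tend to 0. *)
Lemma mixed_schwarz T f g x y :
  {within `[0, +oo[, continuous f} -> {within `[0, +oo[, continuous g} ->
  (forall t, 0 <= t -> f t * g t = t) ->
  rdot (T x) y <= rnorm (cfc f (absop T) x) * rnorm (cfc g (absop (adjoint T)) y).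
Proof.
move=> cf cg fg; set P := absop T; set F := cfc f P; set G' := cfc g _.
have pP : positive P := absop_positive T.
have FG : cfc g P * F = P.
  rewrite cfcM// -[RHS](cfc_id pP); apply: eq_cfc => // t t0.
  by rewrite mulrC fg.
rewrite -subr_le0; apply: (@le0_of_small _ _ (rnorm x * rnorm y)) => d /andP[d0 _].
have PdE z : (P + d%:C *: (1 : bop H)) z = P z + d%:C *: z by [].
have [|||r [rP Pr]] := @coercive_invertible _ _ (P + d%:C *: (1 : bop H)) d.
- by apply: selfadjointD; [exact: pP.1|exact/selfadjointZ/selfadjoint1].
- exact: d0.
- by move=> z; rewrite PdE rdotDl rdotZrl rdotxx lerDr pP.2.
(* Commuting with [P], the inverse [r] also commutes with f(P), by [cfc_intertwine]. *)
have rPC : r * P = P * r.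
  have PS : P * (P + d%:C *: (1 : bop H)) = (P + d%:C *: (1 : bop H)) * P.
    by rewrite mulrDl mulrDr -bop_scalerAl -bop_scalerAr mul1r mulr1.
  by rewrite -[LHS]mulr1 -Pr mulrA -(mulrA r) PS mulrA rP mul1r.
have TE : T = G' * (T * r * F) + d%:C *: (T * r).
  have -> : G' * (T * r * F) = T * P * r.
    rewrite -mulrA (cfc_intertwine pP pP cf rPC) !mulrA.
    rewrite -(cfc_intertwine pP (absop_positive _) cg (absop_intertwine T)).
    by rewrite -(mulrA T) FG.
  by rewrite -[LHS]mulr1 -Pr mulrDl mulrDr -bop_scalerAl mul1r -bop_scalerAr mulrA.
(* With w = r z one has z = P w + d w and ||T w|| = ||P w||; the cross term is nonnegative since P
   is positive. *)
have Tr z : rnorm (T (r z)) <= rnorm z.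
  rewrite -rnorm_absop -/P -(ler_pXn2r (n := 2))// ?nnegrE//.
  have zE : z = P (r z) + d%:C *: r z by rewrite -PdE -[RHS]/((_ * r) z) Pr.
  rewrite {2}zE rnormsqD rdotZrr.
  have := mulr_ge0 (ltW d0) (pP.2 (r z)); have := sqr_ge0 (rnorm (d%:C *: r z)); lra.
have -> : T x = G' (T (r (F x))) + d%:C *: T (r x) by rewrite {1}TE.
rewrite rdotDl rdotZrl (cfc_selfadjoint (absop_positive _) cg).
have := rdot_CS (T (r (F x))) (G' y).
have := ler_wpM2r (rnorm_ge0 (G' y)) (Tr (F x)).
have : d * rdot (T (r x)) y <= d * (rnorm x * rnorm y).
  rewrite ler_pM2l// (le_trans (rdot_CS _ _))//.
  exact: ler_wpM2r.
lra.
Qed.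

(** The phase c is the conjugate of [inner x y] divided by its modulus; it lifts a bound on real
    parts to the modulus. *)
Lemma rnorm_inner_rotation x y : exists2 c : R[i], rnorm c = 1 &
  rnorm (inner x y) = rdot (c *: x) y.
Proof.
have [e|z0] := eqVneq (inner x y) 0.
  exists 1; first by rewrite (_ : 1 = 1%:C)// rnormr normr1.
  by rewrite scale1r /rdot e rnorm0.
have n0 : rnorm (inner x y) != 0 by rewrite rnorm_eq0.
have cc (z : R[i]) : conjc z * z = (rnorm z ^+ 2)%:C.
  by rewrite rmorphXn /= rnormE sqr_normc mulrC.
have nJ (z : R[i]) : rnorm (conjc z) = rnorm z.
  by rewrite /rnorm normcJ.
exists ((rnorm (inner x y))^-1%:C * conjc (inner x y)).
  rewrite (_ : rnorm _ = rnorm ((rnorm (inner x y))^-1%:C : R[i]) * rnorm (conjc (inner x y))).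
    by rewrite rnormr nJ ger0_norm ?invr_ge0// mulVf.
  by apply: (@complexI R); rewrite rmorphM /= !rnormE normrM.
rewrite -scalerA rdotZrl /rdot linearZl_LR /= cc /= expr2.
by rewrite mulKf.
Qed.

Lemma mixed_schwarz_abs T f g x y :
  {within `[0, +oo[, continuous f} -> {within `[0, +oo[, continuous g} ->
  (forall t, 0 <= t -> f t * g t = t) ->
  rnorm (inner (T x) y) <= rnorm (cfc f (absop T) x) * rnorm (cfc g (absop (adjoint T)) y).
Proof.
move=> cf cg fg; have [c c1 ->] := rnorm_inner_rotation (T x) y.
rewrite -linearZ (le_trans (mixed_schwarz _ _ _ cf cg fg))//.
move: (cfc f _) => F; have -> : F (c *: x) = c *: F x by exact: linearZ.
by rewrite (rnormZ c (F x)) c1 mul1r.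
Qed.

Lemma rdot_re_op A x : rdot (re_op A x) x = rdot (A x) x.
Proof.
rewrite -[re_op A x]/(2^-1 *: (A x + adjoint A x)).
rewrite (_ : 2^-1 = (2^-1)%:C); last by rewrite fmorphV rmorph_nat.
rewrite rdotZrl rdotDl (rdotC (adjoint A x)) -adjoint_rdot; lra.
Qed.

Lemma rdot_le_opnorm A x : rnorm x = 1 -> rdot (A x) x <= opnorm A.
Proof.
move=> x1; rewrite (le_trans (rdot_CS _ _))// x1 mulr1.
by have := le_opnorm A x; rewrite x1 mulr1.
Qed.

Lemma cfc_sqr f A : positive A -> {within `[0, +oo[, continuous f} ->
  cfc (fun t => f t ^+ 2) A = cfc f A * cfc f A.
Proof. by move=> pA cf; rewrite cfcM. Qed.

Lemma cfc_pow4 f A : positive A -> {within `[0, +oo[, continuous f} ->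
  cfc (fun t => f t ^+ 4) A = cfc (fun t => f t ^+ 2) A * cfc (fun t => f t ^+ 2) A.
Proof.
move=> pA cf; have cf2 := continuous_ge0M cf cf.
rewrite cfcM//; congr (cfc _ A); apply/funext => t.
by rewrite -exprD.
Qed.

End MixedSchwarz.

(** * Assembly of the upper bound for the alpha-norm *)

Theorem theorem2p1 (R : realType) (H : hilbertType R) (T : bop H)
    (f g : R -> R)
    (f_cont : {within `[0, +oo[, continuous f})
    (g_cont : {within `[0, +oo[, continuous g})
    (f_ge0 : forall t, 0 <= t -> 0 <= f t)
    (g_ge0 : forall t, 0 <= t -> 0 <= g t)
    (fg : forall t, 0 <= t -> f t * g t = t)
    (alpha : R) (alpha01 : 0 <= alpha <= 1) :
  alpha_norm alpha T ^+ 2 <=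
    opnorm ((alpha / 4)%:C *: (cfc (fun t => f t ^+ 4) (absop T)
                           + cfc (fun t => g t ^+ 4) (absop (adjoint T)))
            + (1 - alpha)%:C *: absop T ^+ 2)
    + alpha / 2 * opnorm (re_op (cfc (fun t => f t ^+ 2) (absop T)
                             * cfc (fun t => g t ^+ 2) (absop (adjoint T)))).
Proof.
have /andP[a0 a1] := alpha01.
have pP := absop_positive T; have pP' := absop_positive (adjoint T).
rewrite (cfc_pow4 pP f_cont) (cfc_pow4 pP' g_cont) (cfc_sqr pP f_cont) (cfc_sqr pP' g_cont).
have sF := cfc_selfadjoint pP f_cont; have sG := cfc_selfadjoint pP' g_cont.
have mix x := mixed_schwarz_abs T x x f_cont g_cont fg.
(* From here on, f and g enter only through two self-adjoint operators and the mixed Schwarz bound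
   [mix]. *)
move: (cfc f _) (cfc g _) sF sG mix => F G sF sG mix.
have sF2 : selfadjoint (F * F) := selfadjointM sF sF erefl.
have sG2 : selfadjoint (G * G) := selfadjointM sG sG erefl.
have F2E x : rdot ((F * F) x) x = rnorm (F x) ^+ 2 by rewrite -rdotxx -sF.
have G2E x : rdot ((G * G) x) x = rnorm (G x) ^+ 2 by rewrite -rdotxx -sG.
move: (F * F) (G * G) sF2 sG2 F2E G2E => F2 G2 sF2 sG2 F2E G2E.
set S := _ + _ *: absop T ^+ 2; set C := _ + _ * opnorm _.
have C0 : 0 <= C by rewrite addr_ge0 ?mulr_ge0 ?opnorm_ge0//; lra.
have key x : rnorm x = 1 ->
    alpha * rnorm (inner (T x) x) ^+ 2 + (1 - alpha) * rnorm (T x) ^+ 2 <= C.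
  move=> x1.
  set u := rnorm (F x); set v := rnorm (G x).
  have h1 : rnorm (inner (T x) x) ^+ 2 <= u ^+ 2 * v ^+ 2.
    by rewrite -exprMn ler_pXn2r ?nnegrE// (mulr_ge0 (rnorm_ge0 _) (rnorm_ge0 _)).
  have h2 : 4 * (u ^+ 2 * v ^+ 2) <= (u ^+ 2 + v ^+ 2) ^+ 2.
    by rewrite -subr_ge0 (_ : _ - _ = (u ^+ 2 - v ^+ 2) ^+ 2) ?sqr_ge0//; ring.
  have h3 : (u ^+ 2 + v ^+ 2) ^+ 2 <= rnorm (F2 x + G2 x) ^+ 2.
    rewrite ler_pXn2r// ?nnegrE ?addr_ge0 ?sqr_ge0//.
    by rewrite -F2E -G2E -rdotDl (le_trans (rdot_CS _ _))// x1 mulr1.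
  rewrite rnormsqD in h3.
  have h4 : rdot (S x) x = alpha / 4 * (rnorm (F2 x) ^+ 2 + rnorm (G2 x) ^+ 2)
                           + (1 - alpha) * rnorm (T x) ^+ 2.
    have -> : S x = (alpha / 4)%:C *: (F2 (F2 x) + G2 (G2 x)) +
        (1 - alpha)%:C *: absop T (absop T x).
      by rewrite /S expr2.
    by rewrite rdotDl !rdotZrl rdotDl sF2 sG2 pP.1 !rdotxx rnorm_absop.
  have h5 := rdot_le_opnorm S x1.
  have := rdot_le_opnorm (re_op (F2 * G2)) x1.
  rewrite rdot_re_op -[(F2 * G2) x]/(F2 (G2 x)) sF2 rdotC => h6.
  have h7 := ler_wpM2l a0 h1.
  have h8 : alpha * (4 * (u ^+ 2 * v ^+ 2)) <=
      alpha * (rnorm (F2 x) ^+ 2 + rnorm (G2 x) ^+ 2 + 2 * rdot (F2 x) (G2 x)).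
    by rewrite ler_wpM2l// (le_trans h2 h3).
  have h9 := ler_wpM2l a0 h6.
  rewrite /C; lra.
rewrite /alpha_norm; set E := [set _ | _ in _].
(* On the zero space there is no unit vector, and the supremum of the empty set is 0 by
   convention. *)
have [->|/set0P[w Ew]] := eqVneq E set0; first by rewrite sup0 expr0n.
have EC : ubound E (Num.sqrt C).
  move=> _ [x /= x1 <-]; apply: ler_wsqrtr; apply: key.
  by apply: (@complexI R); rewrite rnormE.
have supE0 : 0 <= sup E.
  apply: (@le_trans _ _ w); first by case: Ew => x _ <-; exact: sqrtr_ge0.
  by apply: sup_ubound => //; exists (Num.sqrt C).
rewrite -[leRHS]sqr_sqrtr// ler_pXn2r// ?nnegrE ?sqrtr_ge0//.
by apply: ge_sup => //; exists w.
Qed.
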